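(* Let $a:\mathbb{N}\to\,]0,+\infty[$, let $r\ge 1$, and let $s$ be a proper divisor of $N$, with $N=ns$. Let $P\in\mathcal{P}(A_{N,r})$ be the $\mathcal{M}^{(a)}_{N,r}$-model. Then $P'=I_s(P)\in\mathcal{P}(A_{n,r})$ is the $\mathcal{M}^{(a')}_{n,r}$-model with $$a'(x)=C^{(a)}_{s,x}.$$
   Context: $\mathbb{N}=\{0,1,2,\dots\}$. For integers $m\ge 1$, $r\ge 0$ let $A_{m,r}=\{\mathbf{x}=(x_1,\dots,x_m): x_j\in\{0,1,\dots,r\},\ \sum_{j=1}^m x_j=r\}$, and let $\mathcal{P}(A_{m,r})$ be the set of probability distributions on $A_{m,r}$. For $a:\mathbb{N}\to\,]0,+\infty[$, put $C^{(a)}_{m,r}=\sum_{\boldsymbol{\eta}\in A_{m,r}}\prod_{j=1}^m a(\eta_j)$. The $\mathcal{M}^{(a)}_{m,r}$-model is the probability distribution on $A_{m,r}$ given by $P\{X_1=x_1,\dots,X_m=x_m\}=\prod_{j=1}^m a(x_j)\big/C^{(a)}_{m,r}$. Merging transformation: let $s$ be a proper divisor of $M$ ($s\neq M$), $M=ms$. Given $P\in\mathcal{P}(A_{M,r})$, write the occupancy numbers in consecutive groups of size $s$ as $(Z_{1,1},\dots,Z_{1,s},\dots,Z_{m,1},\dots,Z_{m,s})\sim P$. Then $I_s(P)\in\mathcal{P}(A_{m,r})$ is the law of $(X_1,\dots,X_m)$, where $X_j=\sum_{h=1}^s Z_{j,h}$. *)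

(* Defs.v *)
From HB Require Import structures.
From mathcomp Require Import all_boot all_order all_algebra.

Set Implicit Arguments.
Unset Strict Implicit.
Unset Printing Implicit Defensive.

Import Order.TTheory GRing.Theory Num.Theory.
Local Open Scope ring_scope.

Record dist (R : realFieldType) (T : finType) := Dist {
  pmf :> T -> R;
  pmf_ge0 : forall x, 0 <= pmf x;
  pmf_sum1 : \sum_x pmf x = 1 }.

Section Law.
Variables (R : realFieldType) (T U : finType) (P : dist R T) (X : T -> U).

Let law_pmf (u : U) : R := \sum_(z | X z == u) P z.

Let law_ge0 u : 0 <= law_pmf u.
Proof. by apply: sumr_ge0 => z _; apply: pmf_ge0. Qed.

Let law_sum1 : \sum_u law_pmf u = 1.
Proof.
rewrite -(pmf_sum1 P) [RHS](partition_big X xpredT) //=.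
Qed.

Definition law : dist R U := Dist law_ge0 law_sum1.

End Law.

(* A_{m,r}, whose coordinates are indexed by 'I_m, that is 0, ..., m-1. *)
Definition occupancy (m r : nat) : finType :=
  {x : {ffun 'I_m -> 'I_r.+1} | (\sum_(j < m) x j == r)%N}.

Definition occ (m r : nat) (x : occupancy m r) (j : 'I_m) : nat := val x j.

(* The normalizing constant C^{(a)}_{m,r}. *)
Definition C (R : realFieldType) (a : nat -> R) (m r : nat) : R :=
  \sum_(eta : occupancy m r) \prod_(j < m) a (occ eta j).

(* P is the M^{(a)}_{m,r}-model; the weights a are meant to be positive. *)
Definition is_M_model (R : realFieldType) (a : nat -> R) (m r : nat)
    (P : dist R (occupancy m r)) : Prop :=
  forall x, P x = (\prod_(j < m) a (occ x j)) / C a m r.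

Section Merge.
Variables (m s r : nat).

Lemma cell_subproof (j : 'I_m) (h : 'I_s) : (j * s + h < m * s)%N.
Proof.
apply: (@leq_trans (j.+1 * s)); last by rewrite leq_mul2r ltn_ord orbT.
by rewrite mulSn addnC ltn_add2r.
Qed.

(* Position of the h-th cell of the j-th group of s consecutive cells. *)
Definition cell (j : 'I_m) (h : 'I_s) : 'I_(m * s) :=
  Ordinal (cell_subproof j h).

Lemma sum_cell (F : 'I_(m * s) -> nat) :
  (\sum_(i < m * s) F i = \sum_(j < m) \sum_(h < s) F (cell j h))%N.
Proof.
rewrite pair_big /= (reindex (fun p => cell p.1 p.2)) //=.
apply: onW_bij; apply: inj_card_bij; last by rewrite card_prod !card_ord.
move=> [j h] [j' h'] /(congr1 val) /= e.
have s_gt0 : (0 < s)%N by apply: leq_ltn_trans (ltn_ord h).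
have ej : j = j'.
  apply: val_inj; have := congr1 (divn^~ s) e.
  by rewrite /= !divnMDl // !divn_small ?ltn_ord // !addn0.
have eh : h = h'.
  by apply: val_inj; move/eqP: e; rewrite ej eqn_add2l => /eqP.
by rewrite ej eh.
Qed.

Definition merge_count (z : occupancy (m * s) r) (j : 'I_m) : nat :=
  (\sum_(h < s) occ z (cell j h))%N.

Lemma sum_merge_count z : (\sum_(j < m) merge_count z j = r)%N.
Proof. by rewrite -(sum_cell (occ z)); apply/eqP/(valP z). Qed.

Lemma merge_count_lt z j : (merge_count z j < r.+1)%N.
Proof. by rewrite ltnS -[leqRHS](sum_merge_count z) (bigD1 j) //= leq_addr. Qed.

Lemma merge_subproof z :
  (\sum_(j < m) [ffun j => Ordinal (merge_count_lt z j)] j == r)%N.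
Proof.
apply/eqP; rewrite -[RHS](sum_merge_count z).
by apply: eq_bigr => j _; rewrite ffunE.
Qed.

Definition merge (z : occupancy (m * s) r) : occupancy m r :=
  exist _ [ffun j => Ordinal (merge_count_lt z j)] (merge_subproof z).

Lemma occ_merge z j : occ (merge z) j = (\sum_(h < s) occ z (cell j h))%N.
Proof. by rewrite /occ /= ffunE. Qed.

(* The transformation I_s, for the factorization M = m * s. *)
Definition merging (R : realFieldType) (P : dist R (occupancy (m * s) r)) :
  dist R (occupancy m r) := law P merge.

End Merge.

Arguments merging m s {r R} P.

(* Non-vacuity: for m >= 1 and positive weights the model exists. *)
Section Existence.
Variables (R : realFieldType) (a : nat -> R) (m r : nat).
Hypotheses (m_gt0 : (0 < m)%N) (a_gt0 : forall x, 0 < a x).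

Let all_in_first : {ffun 'I_m -> 'I_r.+1} :=
  [ffun j => if j == Ordinal m_gt0 then ord_max else ord0].

Let all_in_firstP : (\sum_(j < m) all_in_first j == r)%N.
Proof.
rewrite (bigD1 (Ordinal m_gt0)) //= ffunE eqxx big1 ?addn0 // => j jN0.
by rewrite ffunE (negbTE jN0).
Qed.

Let prod_gt0 (x : occupancy m r) : 0 < \prod_(j < m) a (occ x j).
Proof. by apply: prodr_gt0 => j _. Qed.

Lemma C_gt0 : 0 < C a m r.
Proof.
rewrite /C (bigD1 (exist _ all_in_first all_in_firstP : occupancy m r)) //=.
by rewrite ltr_pwDl // sumr_ge0 // => x _; apply: ltW.
Qed.

Lemma M_model_exists : exists P : dist R (occupancy m r), is_M_model a P.
Proof.
have P_ge0 (x : occupancy m r) : 0 <= (\prod_(j < m) a (occ x j)) / C a m r.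
  by rewrite divr_ge0 ?(ltW C_gt0) ?(ltW (prod_gt0 x)).
have P_sum1 : \sum_(x : occupancy m r) (\prod_(j < m) a (occ x j)) / C a m r = 1.
  by rewrite -mulr_suml mulfV // gt_eqF ?C_gt0.
by exists (Dist P_ge0 P_sum1).
Qed.

End Existence.

(* Main.v *)
Require Import Defs.
From HB Require Import structures.
From mathcomp Require Import all_boot all_order all_algebra.
Import Order.TTheory GRing.Theory Num.Theory.
Local Open Scope ring_scope.

(** A configuration of [n * s] cells merging to [x] is an independent choice,
    for each group [j], of a configuration of [s] cells with total [x j].  By
    distributivity the weights of the fibre of [merge] over [x] therefore add
    up to the product of the [C a s (x j)]; summing this over [x] also
    identifies the two normalizing constants. *)

(* Raising the bound on the coordinates from [k] to [r] lets the groups, whose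
   totals differ, share one index type. *)
Lemma C_widen (R : realFieldType) (a : nat -> R) (m k r : nat) (k_le_r : (k <= r)%N) :
  C a m k = \sum_(f : {ffun 'I_m -> 'I_r.+1} | (\sum_(j < m) f j == k)%N)
              \prod_(j < m) a (f j).
Proof.
pose widen (eta : occupancy m k) : {ffun 'I_m -> 'I_r.+1} :=
  [ffun j => inord (occ eta j)].
pose narrow (f : {ffun 'I_m -> 'I_r.+1}) : option (occupancy m k) :=
  insub [ffun j => inord (f j) : 'I_k.+1].
have widenE eta j : widen eta j = occ eta j :> nat.
  by rewrite ffunE inordK // ltnS (leq_trans _ k_le_r) // -ltnS ltn_ord.
rewrite (reindex_omap widen narrow) => [|f /eqP sum_f]; last first.
  (* No coordinate exceeds the total [k], so the [inord] in [narrow] never takes its default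
     value. *)
  have f_le j : (f j < k.+1)%N.
    by rewrite ltnS -sum_f (bigD1 j) //= leq_addr.
  rewrite /narrow insubT => [|sum_f'] /=.
    apply/eqP; rewrite -[RHS]sum_f; apply: eq_bigr => j _.
    by rewrite ffunE inordK.
  congr Some; apply/ffunP => j; apply: ord_inj.
  by rewrite widenE /occ /= ffunE inordK.
rewrite /C; apply: eq_big => [eta | eta _]; last first.
  by apply: eq_bigr => j _; rewrite widenE.
under eq_bigr => j _ do rewrite widenE.
rewrite [X in X && _](valP eta) /=; symmetry; apply/eqP.
rewrite /narrow (_ : [ffun j => _] = val eta) ?valK //.
by apply/ffunP => j; apply: ord_inj; rewrite ffunE widenE inordK ?ltn_ord.
Qed.

(** Division by [s] recovers [j] as quotient and [h] as remainder of [j * s + h]; equal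
    cardinalities do the rest. *)
Lemma cell_bij (n s : nat) :
  bijective (fun p : 'I_n * 'I_s => cell p.1 p.2).
Proof.
apply: inj_card_bij; last by rewrite card_prod !card_ord.
move=> [j h] [j' h'] /(congr1 val) /= e.
have s_gt0 : (0 < s)%N by apply: leq_ltn_trans (ltn_ord h).
have /= := congr1 (divn^~ s) e; have /= := congr1 (modn^~ s) e.
rewrite !modnMDl !modn_small // !divnMDl // !divn_small // !addn0.
by move=> /val_inj -> /val_inj ->.
Qed.

Lemma prod_cell (R : realFieldType) (n s : nat) (F : 'I_(n * s) -> R) :
  \prod_i F i = \prod_(j < n) \prod_(h < s) F (cell j h).
Proof.
by rewrite pair_bigA (reindex (fun p => cell p.1 p.2)) //=; apply/onW_bij/cell_bij.
Qed.

Lemma sum_merge_fibre (R : realFieldType) (a : nat -> R) (n s r : nat)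
    (x : occupancy n r) :
  \sum_(z : occupancy (n * s) r | Defs.merge z == x) \prod_i a (occ z i) =
  \prod_(j < n) C a s (occ x j).
Proof.
have xr j : (occ x j <= r)%N by rewrite -ltnS ltn_ord.
under [RHS]eq_bigr => j _ do rewrite (C_widen _ _ _ _ _ (xr j)).
(* Distributivity: the product becomes one sum over families [g] in which [g j] has total
   [occ x j]. *)
rewrite bigA_distr_big_dep /=.
have [pos posK cellK] := cell_bij n s.
pose split (z : occupancy (n * s) r) : {ffun 'I_n -> {ffun 'I_s -> 'I_r.+1}} :=
  [ffun j => [ffun h => val z (cell j h)]].
pose join (g : {ffun 'I_n -> {ffun 'I_s -> 'I_r.+1}}) :
    option (occupancy (n * s) r) :=
  insub [ffun i => g (pos i).1 (pos i).2].
have pos_cell j h : pos (cell j h) = (j, h) by exact: (posK (j, h)).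
rewrite [RHS](reindex_omap split join) => [|g /familyP g_fam]; last first.
  (* [join] succeeds here because the group totals [occ x j] add up to [r]. *)
  rewrite /join insubT => [|sum_g] /=.
    apply/eqP; rewrite sum_cell -[RHS](eqP (valP x)); apply: eq_bigr => j _.
    rewrite -[RHS](eqP (g_fam j)); apply: eq_bigr => h _.
    by rewrite ffunE pos_cell.
  by congr Some; apply/ffunP => j; apply/ffunP => h; rewrite !ffunE pos_cell.
apply: eq_big => [z | z _]; last first.
  rewrite prod_cell; apply: eq_bigr => j _; apply: eq_bigr => h _.
  by rewrite !ffunE.
have -> : join (split z) = Some z.
  rewrite /join (_ : [ffun i => _] = val z) ?valK //.
  by apply/ffunP => i; rewrite !ffunE cellK.
have splitE j : (\sum_h split z j h)%N = occ (Defs.merge z) j.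
  by rewrite occ_merge; apply: eq_bigr => h _; rewrite !ffunE.
(* Lying in the fibre over [x] is a condition on each group total separately, hence membership of
   [split z] in the family. *)
rewrite eqxx andbT; apply/eqP/familyP => [<- j | z_fam].
  by apply/eqP; exact: splitE.
apply: val_inj; apply/ffunP => j; apply: val_inj.
by rewrite -[LHS]splitE; apply/eqP/z_fam.
Qed.

Lemma C_merge (R : realFieldType) (a : nat -> R) (n s r : nat) :
  C a (n * s) r = C (C a s) n r.
Proof.
rewrite {1}/C (partition_big (@Defs.merge n s r) xpredT) //=.
by apply: eq_bigr => x _; exact: sum_merge_fibre.
Qed.

Theorem proposition3p2 (R : realFieldType) (a : nat -> R) (n s r : nat)
    (a_gt0 : forall x : nat, 0 < a x)
    (r_ge1 : (1 <= r)%N)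
    (N_gt0 : (0 < n * s)%N) (s_proper : s <> (n * s)%N)
    (P : dist R (occupancy (n * s) r)) (P_model : is_M_model a P) :
  (forall x : nat, 0 < C a s x) /\
  is_M_model (fun x : nat => C a s x) (merging n s P).
Proof.
split=> [x | x].
  by apply: C_gt0 => //; move: N_gt0; rewrite muln_gt0 => /andP[].
(* Eta-contracting the weight lets [C_merge] apply; both sides are then sums over the fibre over
   [x], compared termwise. *)
rewrite -[C (fun _ => _) _ _]/(C (C a s) n r) -C_merge -sum_merge_fibre.
by rewrite mulr_suml; apply: eq_bigr => z _; exact: P_model.
Qed.
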